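(* Let $q=p^n$ be a power of a prime $p$. Let $\ell$ and $r$ be integers with $\ell\geq 2$ and $r\geq 0$ such that $\ell/u$ is even, where $u=\gcd(\ell,r)$. Let $\mathbf{T}:\mathbb{F}_{q^\ell}\to\mathbb{F}_q$ be the trace map, let $a,b,c\in\mathbb{F}_{q^\ell}$ with $a\neq 0$, and let $f(x)=a^{q^r}x^{q^{2r}}+ax$. If $f(x)=-b^{q^r}$ has no roots in $\mathbb{F}_{q^\ell}$, then $N_{\ell,r}(a,b,c)=q^\ell$. Otherwise, let $x_0\in\mathbb{F}_{q^\ell}$ be a root of $f(x)=-b^{q^r}$ and set $c_1=ax_0^{q^r+1}-c$. (1) If $f(x)$ is a permutation polynomial over $\mathbb{F}_{q^\ell}$, then $$N_{\ell,r}(a,b,c)=q^\ell+\begin{cases} (-1)^{\ell/(2u)}\,q^{\ell/2}(q-1), & \text{if } \mathbf{T}(c_1)=0,\\ (-1)^{\ell/(2u)+1}\,q^{\ell/2}, & \text{if } \mathbf{T}(c_1)\neq 0.\end{cases}$$ (2) If $f(x)$ is not a permutation polynomial over $\mathbb{F}_{q^\ell}$, then $$N_{\ell,r}(a,b,c)=q^\ell+\begin{cases} (-1)^{\ell/(2u)+1}\,q^{\ell/2+u}(q-1), & \text{if } \mathbf{T}(c_1)=0,\\ (-1)^{\ell/(2u)}\,q^{\ell/2+u}, & \text{if } \mathbf{T}(c_1)\neq 0.\end{cases}$$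
   Context: For $a,b,c\in\mathbb{F}_{q^\ell}$ with $a\neq 0$, $N_{\ell,r}(a,b,c)$ denotes the number of $\mathbb{F}_{q^\ell}$-rational affine points of the curve $y^q-y=ax^{q^r+1}+bx+c$, i.e. the number of pairs $(x,y)\in\mathbb{F}_{q^\ell}^2$ satisfying this equation. By convention $\gcd(\ell,0)=\ell$. A polynomial is a permutation polynomial over $\mathbb{F}_{q^\ell}$ if it induces a bijection of $\mathbb{F}_{q^\ell}$. *)

(* Defs.v *)
From mathcomp Require Import all_boot all_order all_fingroup all_algebra all_field.

Set Implicit Arguments.
Unset Strict Implicit.
Unset Printing Implicit Defensive.

Import GRing.Theory.
Local Open Scope ring_scope.

Definition affine_points (F : finFieldType) (q r : nat) (a b c : F) :
    {set F * F} :=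
  [set P | P.2 ^+ q - P.2 == a * P.1 ^+ (q ^ r + 1)%N + b * P.1 + c].

Definition num_points (F : finFieldType) (q r : nat) (a b c : F) : nat :=
  #|affine_points q r a b c|.

Definition permutation_poly (F : finFieldType) (g : {poly F}) : Prop :=
  bijective (fun x : F => g.[x]).

Definition f_poly (F : finFieldType) (q r : nat) (a : F) : {poly F} :=
  a ^+ (q ^ r)%N *: 'X^(q ^ (2 * r))%N + a *: 'X.

(* An extension L of a finite field K is finite only through its alias
   finvect_type L, which is at once a finFieldType and a splittingFieldType
   over K; {:finvect_type L} is all of L and 1%VS is the copy of K in L. *)
Definition field_trace (K : finFieldType) (L : fieldExtType K)
    (x : finvect_type L) : finvect_type L :=
  galTrace 1%VS {:finvect_type L} x.

(* Main.v *)
Require Import Defs.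
From mathcomp Require Import all_boot all_order all_fingroup all_algebra all_field.
From mathcomp Require Import cyclic zify ring.

Set Implicit Arguments.
Unset Strict Implicit.
Unset Printing Implicit Defensive.

Import GRing.Theory.
Local Open Scope ring_scope.

(** The proof counts points and never leaves the finite field: signs that are
    usually read off from Gauss sums come here from a congruence.

    Write [F] for the field with [q ^ l] elements, [T] for the trace to the
    subfield of [q] elements and [s = q ^ u].  The equation [y ^ q - y = w] has
    [q] solutions if [T w = 0] and none otherwise (additive Hilbert 90,
    [card_Artin_Schreier]), so the number of points is [q] times the number of
    zeros of [T (a x ^ (q ^ r + 1) + b x + c)].  The leading term
    [Q x = T (a x ^ (q ^ r + 1))] satisfies
      [Q (x + z) = Q x + T (x ^ (q ^ r) * f z) + Q z]   ([formD]),
    hence its radical is the kernel [W] of [f].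

    If [f x0 = - b ^ (q ^ r)], the translation [x |-> x + x0] completes the
    square and leaves the level set [Q x = T c1] ([card_fibre_root]).  If there
    is no such [x0], then a duality between the image of [f] and the orthogonal
    of [W] gives [z] in [W] with [T (b z) != 0]; translations by multiples of
    [z] permute the level sets, which therefore all have the same size
    ([card_fibre_no_root]).

    It remains to find the level sets of [Q].  Because [l / u] is even and
    [r / u] is odd, [Q] is the trace of a Hermitian form for the quadratic
    extension of the field of [s] elements inside [F]: a scalar [h] with
    [h ^ (s + 1)] in the base field multiplies [Q] by that norm ([form_scale]).
    Norms being surjective, all level sets over nonzero values have the same
    size [Z1], and everything is determined by the gap [S = Z0 - Z1], where [Z0]
    is the number of zeros of [Q].

    - Counting the pairs [(x, y)] with [Q x = Q y] in two ways gives
      [S ^ 2 = |W| * q ^ l] ([gap_sqr]).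
    - The kernel [W] is zero or a line over the field of [s ^ 2] elements
      ([card_radical]), so with [l = 2 u k] the gap [S] is, up to sign,
      [s ^ (k + i)], where [i = 0] if [f] is a permutation polynomial and
      [i = 1] if not.
    - The scalars of norm one form a group of order [s + 1] that acts freely on
      nonzero vectors and preserves level sets, so [S] is [1] modulo [s + 1]
      ([gap_mod]).  As [s] is [-1] modulo [s + 1] and [s + 1 > 2], the sign of
      [S] is [(-1) ^ (k + i)] ([gapE]). *)

(** * Roots of unity in a finite field *)

Section MultiplicativeGroup.

Variable F : finFieldType.

Lemma neq0_unity_root (x : F) : x != 0 -> x ^+ #|F|.-1 = 1.
Proof.
move=> x_neq0; apply/(mulfI x_neq0).
by rewrite -exprS prednK ?mulr1 ?expf_card // ltnW // finNzRing_gt1.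
Qed.

Lemma finField_prim_root : exists g : F, #|F|.-1.-primitive_root g.
Proof.
have F_gt1 := finNzRing_gt1 F.
have N_gt0 : (0 < #|F|.-1)%N by rewrite -ltnS prednK // ltnW.
pose rs := enum [set x : F | x != 0].
have rsP x : (x \in rs) = (x != 0) by rewrite mem_enum inE.
have /hasP[g _ g_prim]: has #|F|.-1.-primitive_root rs; last by exists g.
apply: has_prim_root => //; rewrite ?enum_uniq //.
  apply/allP=> x; rewrite rsP => x_neq0; rewrite unity_rootE.
  exact/eqP/neq0_unity_root.
rewrite -cardE; have := cardsC [set (0 : F)]; rewrite cards1 => <-.
by rewrite add1n /= subset_leq_card //; apply/subsetP=> x; rewrite !inE.
Qed.

Lemma card_unity_roots d :
  (d %| #|F|.-1)%N -> #|[set x : F | x ^+ d == 1]| = d.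
Proof.
move=> d_dvd; have [g g_prim] := finField_prim_root.
have h_prim := dvdn_prim_root g_prim d_dvd; set h := g ^+ _ in h_prim.
have -> : [set x : F | x ^+ d == 1] = [set h ^+ i | i : 'I_d].
  apply/setP=> x; rewrite inE; apply/eqP/imsetP => [/(prim_rootP h_prim)|].
    by case=> i ->; exists i.
  by case=> i _ ->; rewrite exprAC (prim_expr_order h_prim) expr1n.
rewrite card_imset ?card_ord // => i j /eqP.
rewrite (eq_prim_root_expr h_prim) !modn_small // => /eqP.
exact: val_inj.
Qed.

(** In a cyclic group of order divisible by [d * e], the subgroup of exponent [e]
    lies in the subgroup of [d]-th powers.  With [d = s + 1] and [e = s - 1] this
    is the surjectivity of the norm from [s ^ 2] to [s] elements. *)
Lemma unity_root_is_power d e (t : F) :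
  (d * e %| #|F|.-1)%N -> t ^+ e = 1 -> exists x : F, x ^+ d = t.
Proof.
have F_gt1 := finNzRing_gt1 F.
have N_gt0 : (0 < #|F|.-1)%N by rewrite -ltnS prednK // ltnW.
case/dvdnP=> k Dk te1; have [g g_prim] := finField_prim_root.
have e_gt0 : (0 < e)%N by move: N_gt0; rewrite Dk; case: (e); rewrite ?muln0.
have t_neq0 : t != 0.
  apply: contra_eq_neq te1 => ->.
  by rewrite expr0n eqn0Ngt e_gt0 eq_sym oner_neq0.
have [[i lt_i] /= Di] := prim_rootP g_prim (neq0_unity_root t_neq0).
have : (#|F|.-1 %| i * e)%N.
  by rewrite (prim_order_dvd g_prim) exprM -Di te1.
rewrite {lt_i} Dk mulnA dvdn_pmul2r // => /dvdnP[j Dj].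
by exists (g ^+ (j * k)); rewrite -exprM -mulnA -Dj.
Qed.

(** The [d]-th roots of unity act freely by multiplication on nonzero elements;
    their orbits are the fibres of [x |-> x ^ d]. *)
Lemma dvdn_card_unity_stable d (A : {set F}) :
    (d %| #|F|.-1)%N -> 0 \notin A ->
    (forall h x, h ^+ d = 1 -> x \in A -> h * x \in A) ->
  (d %| #|A|)%N.
Proof.
move=> d_dvd A0 A_stable.
rewrite -sum1_card (partition_big_imset (fun x : F => x ^+ d)) /=.
apply: dvdn_sum => _ /imsetP[x Ax ->].
have x_neq0 : x != 0 by apply: contraNneq A0 => <-.
rewrite sum1dep_card -[X in (X %| _)%N](card_unity_roots d_dvd).
rewrite -(card_imset _ (mulIf x_neq0)) /=.
rewrite (_ : [set y in A | y ^+ d == x ^+ d]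
           = [set h * x | h in [set h | h ^+ d == 1]]) //.
apply/setP=> y; rewrite !inE; apply/andP/imsetP.
  case=> Ay /eqP eq_yx; exists (y / x); last by rewrite divfK.
  by rewrite inE expr_div_n eq_yx divff // expf_neq0.
case=> h; rewrite inE => /eqP h1 ->; split; first exact: A_stable.
by rewrite exprMn h1 mul1r.
Qed.

End MultiplicativeGroup.

(** * The trace to the subfield of [q] elements *)

Lemma card_additive_kernel_image (F : finFieldType) (g : F -> F) :
    {morph g : x y / x - y} ->
  (#|[set g x | x : F]| * #|[set x | g x == 0%R]|)%N = #|F|.
Proof.
move=> gB; rewrite -[RHS]sum1_card.
rewrite (partition_big_imset g) /= -sum_nat_const.
apply: eq_bigr => _ /imsetP[x _ ->].
rewrite -(card_imset _ (addIr x)) sum1dep_card; apply: eq_card => y.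
rewrite !inE; apply/imsetP/eqP.
  case=> z; rewrite inE => /eqP gz0 ->.
  by apply/eqP; rewrite -subr_eq0 -gB addrK gz0.
by move=> eq_g; exists (y - x); rewrite ?subrK // inE gB eq_g subrr.
Qed.

Section Frobenius.

Variables (F : finFieldType) (q l : nat).
Hypotheses (q_char : [pchar F].-nat q) (cardF : #|F| = (q ^ l)%N).

Lemma q_gt0 : (0 < q)%N.
Proof. by case/andP: q_char. Qed.

Lemma FrobD i : {morph (fun x : F => x ^+ (q ^ i)) : x y / x + y}.
Proof. by move=> x y; rewrite exprDn_pchar // pnatX q_char. Qed.

Lemma Frob_gt0 i : (0 < q ^ i)%N.
Proof. by rewrite expn_gt0 q_gt0. Qed.

Lemma Frob0 i : (0 : F) ^+ (q ^ i) = 0.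
Proof. by rewrite expr0n eqn0Ngt Frob_gt0. Qed.

Lemma FrobN i : {morph (fun x : F => x ^+ (q ^ i)) : x / - x}.
Proof. by move=> x; apply/eqP; rewrite -addr_eq0 -FrobD addNr Frob0. Qed.

Lemma FrobB i : {morph (fun x : F => x ^+ (q ^ i)) : x y / x - y}.
Proof. by move=> x y; rewrite FrobD FrobN. Qed.

Lemma Frob_sum i (I : Type) (s : seq I) (P : pred I) (E : I -> F) :
  (\sum_(j <- s | P j) E j) ^+ (q ^ i) = \sum_(j <- s | P j) E j ^+ (q ^ i).
Proof. exact: (big_morph _ (FrobD i) (Frob0 i)). Qed.

Lemma Frob_inj i : injective (fun x : F => x ^+ (q ^ i)).
Proof.
move=> x y /eqP; rewrite -subr_eq0 -FrobB expf_eq0 => /andP[_].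
by rewrite subr_eq0 => /eqP.
Qed.

Lemma Frob_surj i (y : F) : exists x, x ^+ (q ^ i) = y.
Proof. by have [g _ gK] := injF_bij (@Frob_inj i); exists (g y). Qed.

Lemma Frob_period i j (x : F) :
  x ^+ (q ^ i) = x -> x ^+ (q ^ (j * i)) = x.
Proof.
by move=> xi; elim: j => [|j IHj]; rewrite ?expn0 ?expr1 // mulSn expnD exprM xi.
Qed.

Lemma Frob_full (x : F) : x ^+ (q ^ l) = x.
Proof. by rewrite -cardF expf_card. Qed.

(** Bezout: [i * k = gcd + a * j] for some [k] and [a], and both [i * k] and
    [a * j] Frobenius steps fix [x]. *)
Lemma Frob_gcd i j (x : F) :
  x ^+ (q ^ i) = x -> x ^+ (q ^ j) = x -> x ^+ (q ^ gcdn i j) = x.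
Proof.
case: (posnP i) => [-> | i_gt0 xi xj]; first by rewrite gcd0n.
have [a _ /dvdnP[k Dk]] := Bezoutl j i_gt0.
rewrite -[X in X ^+ _ = _](Frob_period a xj) -exprM -expnD addnC Dk.
exact: Frob_period.
Qed.

Lemma q_gt1 : (1 < q)%N.
Proof.
have:= finNzRing_gt1 F; rewrite cardF.
have:= q_gt0; case: (q) => [|[|k]] //.
by rewrite exp1n.
Qed.

Lemma l_gt0 : (0 < l)%N.
Proof. by have:= finNzRing_gt1 F; rewrite cardF; case: (l). Qed.

Lemma card_Frob_fixed d :
  (0 < d)%N -> (d %| l)%N -> #|[set x : F | x ^+ (q ^ d) == x]| = (q ^ d)%N.
Proof.
move=> d_gt0 /dvdnP[k Dl].
have qd_gt0 := Frob_gt0 d.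
have dvd_qd : ((q ^ d).-1 %| #|F|.-1)%N.
  by rewrite cardF Dl mulnC expnM dvdn_pred_predX.
rewrite (cardsD1 0) inE Frob0 eqxx -[RHS](prednK qd_gt0) add1n.
congr _.+1; rewrite -[RHS](card_unity_roots dvd_qd).
apply: eq_card => x; rewrite !inE -{1}(prednK qd_gt0) exprS.
case: eqP => [->|/eqP x_neq0] /=.
  rewrite expr0n eq_sym -subn1 subn_eq0 leqNgt -{1}(expn0 q).
  by rewrite ltn_exp2l ?q_gt1 ?d_gt0 //= oner_eq0.
by rewrite -[X in _ == X]mulr1 (inj_eq (mulfI x_neq0)).
Qed.

Definition Fq := [set t : F | t ^+ q == t].

Lemma FqP t : reflect (t ^+ q = t) (t \in Fq).
Proof. by rewrite inE; apply: eqP. Qed.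

Lemma card_Fq : #|Fq| = q.
Proof. by rewrite -[RHS]expn1 -(card_Frob_fixed (d := 1)) ?dvd1n. Qed.

Lemma Fq_Frob t i : t \in Fq -> t ^+ (q ^ i) = t.
Proof. by rewrite -[i]muln1 => /FqP tq; apply: Frob_period. Qed.

Lemma Fq0 : 0 \in Fq. Proof. by apply/FqP; rewrite -(expn1 q) Frob0. Qed.

Lemma card_Fq_neq0 : #|Fq :\ 0| = q.-1.
Proof. by rewrite -[q in RHS]card_Fq [in RHS](cardsD1 0) Fq0. Qed.

Lemma FqB s t : s \in Fq -> t \in Fq -> s - t \in Fq.
Proof.
move=> /(Fq_Frob 1) Fs /(Fq_Frob 1) Ft.
by apply/FqP; rewrite -(expn1 q) FrobB Fs Ft.
Qed.

Lemma FqM s t : s \in Fq -> t \in Fq -> s * t \in Fq.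
Proof. by move=> /FqP Fs /FqP Ft; apply/FqP; rewrite exprMn Fs Ft. Qed.

Lemma FqV t : t \in Fq -> t^-1 \in Fq.
Proof. by move=> /FqP Ft; apply/FqP; rewrite exprVn Ft. Qed.

(** A translation by a multiple of [v] carries any level set of [P] to any other.
    This one argument gives the fibres of linear forms and, in the case without
    root, those of the quadratic function itself. *)
Lemma translation_equidistribution (U : {set F}) (P : F -> F) (v c : F) :
    (forall x s, x \in U -> s \in Fq -> x + s * v \in U) ->
    (forall x, x \in U -> P x \in Fq) -> c \in Fq -> c != 0 ->
    (forall x s, x \in U -> s \in Fq -> P (x + s * v) = P x + s * c) ->
  forall t, t \in Fq -> (#|[set x in U | P x == t]| * q)%N = #|U|.
Proof.
move=> U_stable P_Fq Fc c_neq0 P_shift t Ft; apply/esym.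
have le_fib s s' : s \in Fq -> s' \in Fq ->
    (#|[set x in U | P x == s]| <= #|[set x in U | P x == s']|)%N.
  move=> Fs Fs'; have Fd : (s' - s) / c \in Fq by rewrite FqM ?FqB ?FqV.
  rewrite -(card_imset _ (addIr ((s' - s) / c * v))).
  apply/subset_leq_card/subsetP=> _ /imsetP[x /[!inE] /andP[Ux /eqP Px] ->].
  by rewrite U_stable // P_shift // Px divfK // addrC subrK eqxx.
rewrite -sum1_card (partition_big P (mem Fq)) //=.
rewrite mulnC -[q in RHS]card_Fq -sum_nat_const; apply: eq_bigr => s Fs.
by rewrite sum1dep_card; apply/eqP; rewrite eqn_leq !le_fib.
Qed.

Definition trace (x : F) := \sum_(i < l) x ^+ (q ^ i).

Lemma traceD : {morph trace : x y / x + y}.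
Proof. by move=> x y; rewrite -big_split; apply: eq_bigr => i _; apply: FrobD. Qed.

Lemma traceN : {morph trace : x / - x}.
Proof. by move=> x; rewrite -sumrN; apply: eq_bigr => i _; apply: FrobN. Qed.

Lemma traceB : {morph trace : x y / x - y}.
Proof. by move=> x y; rewrite traceD traceN. Qed.

Lemma trace0 : trace 0 = 0.
Proof. by rewrite /trace big1 // => i _; apply: Frob0. Qed.

Lemma traceZ t (x : F) : t \in Fq -> trace (t * x) = t * trace x.
Proof.
move=> Ft; rewrite mulr_sumr; apply: eq_bigr => i _.
by rewrite exprMn Fq_Frob.
Qed.

Lemma trace_Frob1 (x : F) : trace (x ^+ q) = trace x.
Proof.
have:= Frob_full x; rewrite /trace; case: (l) l_gt0 => // m _ xm.
rewrite big_ord_recr big_ord_recl /= expn0 expr1 addrC -exprM -expnS xm.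
by congr (_ + _); apply: eq_bigr => i _; rewrite -exprM -expnS.
Qed.

Lemma trace_Frob i (x : F) : trace (x ^+ (q ^ i)) = trace x.
Proof.
by elim: i => [|i IHi]; rewrite ?expn0 ?expr1 // expnSr exprM trace_Frob1.
Qed.

Lemma trace_Fq x : trace x \in Fq.
Proof.
apply/FqP; rewrite -[RHS]trace_Frob1 -{1}(expn1 q) /trace Frob_sum.
by apply: eq_bigr => i _; rewrite exprAC expn1.
Qed.

(** The trace is a polynomial function of degree [q ^ (l - 1)], which is too small
    for it to vanish on all [q ^ l] elements. *)
Lemma trace_neq0 : exists x, trace x != 0.
Proof.
pose p : {poly F} := \sum_(i < l) 'X^(q ^ i).
have pE x : p.[x] = trace x.
  by rewrite horner_sum; apply: eq_bigr => i _; rewrite hornerXn.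
have [/existsP // | /existsPn trace0] := boolP [exists x, trace x != 0].
have size_p : size p = (q ^ l.-1).+1.
  rewrite /p -(prednK l_gt0) big_ord_recr /= addrC size_polyDl size_polyXn //.
  rewrite ltnS; apply: (leq_trans (size_sum _ _ _)).
  apply/bigmax_leqP=> i _.
  by rewrite size_polyXn ltn_exp2l ?q_gt1.
have p_neq0 : p != 0 by rewrite -size_poly_eq0 size_p.
have p_roots : all (root p) (enum F).
  by apply/allP=> x _; rewrite rootE pE -[_ == _]negbK trace0.
have := max_poly_roots p_neq0 p_roots (enum_uniq F).
rewrite -cardE cardF size_p ltnS leqNgt ltn_exp2l ?q_gt1 //.
by rewrite prednK ?l_gt0 // leqnn.
Qed.

Lemma trace_equidistribution (U : {set F}) (z v : F) :
    (forall x s, x \in U -> s \in Fq -> x + s * v \in U) -> trace (v * z) != 0 ->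
  forall t, t \in Fq -> (#|[set x in U | trace (x * z)%R == t]| * q)%N = #|U|.
Proof.
move=> U_stable Tv; apply: (translation_equidistribution U_stable) Tv _ => //.
- by move=> x _; apply: trace_Fq.
- exact: trace_Fq.
by move=> x s _ Fs; rewrite mulrDl -mulrA traceD (traceZ _ Fs).
Qed.

Lemma card_trace_kernel : (#|[set x | trace x == 0%R]| * q)%N = #|F|.
Proof.
have [x Tx] := trace_neq0; rewrite -[x]mulr1 in Tx.
rewrite -[RHS]cardsT -[RHS](trace_equidistribution _ Tx Fq0) => [|? ?];
  rewrite ?in_setT //.
by congr (_ * _)%N; apply: eq_card => y; rewrite !inE mulr1.
Qed.

(** Additive Hilbert 90: the image of [y |-> y ^ q - y] lies in the kernel of the
    trace, and both have [#|F| / q] elements. *)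
Lemma card_Artin_Schreier (w : F) :
  #|[set y : F | y ^+ q - y == w]| = if trace w == 0 then q else 0%N.
Proof.
pose g (y : F) := y ^+ q - y.
have gB : {morph g : x y / x - y}.
  by move=> x y; rewrite /g -(expn1 q) FrobB [- (x - y)]opprD addrACA -opprD.
have ker_g : [set x | g x == 0] = Fq by apply/setP=> x; rewrite !inE subr_eq0.
have im_g : [set g x | x : F] = [set x | trace x == 0].
  apply/eqP; rewrite eqEcard; apply/andP; split.
    by apply/subsetP=> _ /imsetP[x _ ->]; rewrite inE traceB trace_Frob1 subrr.
  rewrite -(leq_pmul2r q_gt0) card_trace_kernel.
  by rewrite -(card_additive_kernel_image gB) ker_g card_Fq.
have [] := boolP (w \in [set g x | x : F]); last first.
  move=> w_im; have:= w_im; rewrite {1}im_g inE => /negbTE->.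
  apply: eq_card0 => y; apply: contraNF w_im.
  by rewrite inE => /eqP <-; apply: imset_f.
move=> w_im; have:= w_im; rewrite {1}im_g inE => ->.
case/imsetP: w_im => x _ ->.
rewrite -[RHS]card_Fq -ker_g -[RHS](card_imset _ (addIr x)).
apply: eq_card => y; rewrite !inE -/(g y); apply/eqP/imsetP.
  by move=> eq_g; exists (y - x); rewrite ?subrK // inE gB eq_g subrr.
case=> z; rewrite inE => /eqP gz0 ->.
by apply/eqP; rewrite -subr_eq0 -gB addrK gz0.
Qed.

Lemma trace_form_nondeg (v : F) : v != 0 -> exists x, trace (x * v) != 0.
Proof. by have [x Tx] := trace_neq0; exists (x / v); rewrite divfK. Qed.

Definition trace_orthogonal (U : {set F}) :=
  [set z | [forall x in U, trace (x * z) == 0]].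

Lemma trace_orthogonalP (U : {set F}) z :
  reflect {in U, forall x, trace (x * z) = 0} (z \in trace_orthogonal U).
Proof. by rewrite inE; apply: 'forall_in_eqP. Qed.

(** Count the pairs [(x, z)] with [x] in [U] and [trace (x * z) = 0]: for a fixed
    first or second entry, the condition is void or cuts out one element in [q]. *)
Lemma card_orthogonal (U : {set F}) :
    0 \in U -> (forall x y s, x \in U -> y \in U -> s \in Fq -> x + s * y \in U) ->
  (#|U| * #|trace_orthogonal U|)%N = #|F|.
Proof.
move=> U0 U_stable.
pose E := (\sum_(x in U) #|[set z : F | trace (x * z)%R == 0%R]|)%N.
have E1 : (E * q = #|F| * q + (#|U| - 1) * #|F|)%N.
  rewrite /E big_distrl /= (big_setD1 0) //=; congr (_ * _ + _)%N.
    by rewrite -cardsT; apply: eq_card => z; rewrite !inE mul0r trace0 eqxx.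
  rewrite (cardsD1 0 U) U0 addKn -sum_nat_const; apply: eq_bigr => x.
  rewrite !inE => /andP[x_neq0 _]; have [v Tv] := trace_form_nondeg x_neq0.
  rewrite -[RHS]cardsT -[RHS](trace_equidistribution _ Tv Fq0) => [|? ?];
    rewrite ?in_setT //.
  by congr (_ * _)%N; apply: eq_card => z; rewrite !inE mulrC.
have E2 : (E * q = #|trace_orthogonal U| * (#|U| * q)
                   + (#|F| - #|trace_orthogonal U|) * #|U|)%N.
  have -> : E = (\sum_z #|[set x in U | trace (x * z)%R == 0%R]|)%N.
    rewrite /E (eq_bigr (fun x => \sum_(z | trace (x * z)%R == 0%R) 1)%N)
      => [|x _]; last first.
      by rewrite sum1dep_card; apply: eq_card => z; rewrite !inE.
    rewrite (exchange_big_dep xpredT) //=; apply: eq_bigr => z _.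
    by rewrite sum1dep_card; apply: eq_card => x; rewrite !inE.
  rewrite big_distrl /= (bigID (mem (trace_orthogonal U))) /=; congr (_ + _)%N.
    rewrite -sum_nat_const; apply: eq_bigr => z /trace_orthogonalP Oz.
    by congr (_ * _)%N; apply: eq_card => x; rewrite inE andb_idr // => /Oz ->.
  rewrite -(cardsC (trace_orthogonal U)) addKn -sum_nat_const.
  rewrite [RHS](eq_bigl (fun z => z \notin trace_orthogonal U)) => [|z]; last first.
    by rewrite inE.
  apply: eq_bigr => z; rewrite inE negb_forall_in => /exists_inP[v Uv Tv].
  by apply: (trace_equidistribution _ Tv Fq0) => x s Ux Fs; apply: U_stable.
have leO : (#|trace_orthogonal U| <= #|F|)%N by apply: max_card.
have U_gt0 : (0 < #|U|)%N by rewrite (cardD1 0) U0.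
have := E1; rewrite {}E2; move: (#|F|) (#|U|) (#|trace_orthogonal U|) q_gt1 leO U_gt0.
clear. move=> N m o q1 leO m_gt0 E.
apply/eqP; rewrite -(eqn_pmul2r (m := q.-1)); nia.
Qed.

End Frobenius.

(** * Two arithmetical lemmas *)

(** [A] and [B] stand for the sizes of the level sets over [0] and over each of the
    [q - 1] nonzero values, [M] for the size of the space and [R] for that of the
    radical.  The identity is
      [(q - 1) (A - B) ^ 2 = q (A ^ 2 + (q - 1) B ^ 2) - (A + (q - 1) B) ^ 2]. *)
Lemma two_level_variance (q A B R M : nat) :
    (1 < q)%N -> (R <= M)%N -> (A + q.-1 * B = M)%N ->
    ((A ^ 2 + q.-1 * B ^ 2) * q = R * (M * q) + (M - R) * M)%N ->
  (A%:Z - B%:Z) ^+ 2 = (R * M)%N%:Z.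
Proof.
case: q => // c; rewrite ltnS => c_gt0 leRM DM D2 /=.
have [e De] : exists e, M = (R + e)%N by exists (M - R)%N; rewrite subnKC.
have {}D2 : (A * A + c * (B * B)) * c.+1 = R * (M * c.+1) + e * M.
  by move: D2; rewrite {2}De addKn.
have c_neq0 : c%:Z != 0 by rewrite eqz_nat -lt0n.
apply: (mulfI c_neq0); apply/eqP; rewrite -subr_eq0; apply/eqP.
have {}DM : A%:Z + c%:Z * B%:Z = M%:Z by rewrite -DM.
have {}De : e%:Z = M%:Z - R%:Z by rewrite De PoszD addrC addKr.
have : (A%:Z * A%:Z + c%:Z * (B%:Z * B%:Z)) * (c%:Z + 1)
    = R%:Z * (M%:Z * (c%:Z + 1)) + e%:Z * M%:Z.
  by have := congr1 Posz D2; rewrite -addn1 !(PoszD, PoszM).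
move/eqP; rewrite -subr_eq0 => /eqP D; rewrite -[RHS]D De -DM PoszM -DM.
ring.
Qed.

Lemma succ_ndvd2 (t : nat) (n : int) : (1 < t)%N -> n * (t%:Z + 1) != 2.
Proof.
move=> t_gt1; apply/eqP => E; have : (t.+1 %| 2)%N.
  have <- : `|(n * (t%:Z + 1))%R|%N = 2%N by rewrite E.
  by rewrite abszM -PoszD addn1 absz_nat dvdn_mull.
by move/dvdn_leq => /(_ isT); rewrite ltnS leqNgt t_gt1.
Qed.

(** * The form [T (a x ^ (q ^ r + 1))] *)

(** The conditions on [l] and [r] hold with [u = gcd(l, r)] when [l / u] is even. *)
Section HermitianForm.

Variables (F : finFieldType) (q l r u k j : nat) (a : F).
Hypotheses (q_char : [pchar F].-nat q) (cardF : #|F| = (q ^ l)%N).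
Hypotheses (l_def : l = (2 * u * k)%N) (r_def : r = (u * j.*2.+1)%N).
Hypothesis gcd_rl : gcdn (2 * r) l = (2 * u)%N.
Hypothesis a_neq0 : a != 0.

Local Notation T := (@trace F q l).
Local Notation K := (Fq F q).

Definition form (x : F) := T (a * x ^+ (q ^ r + 1)).
Definition polar (z : F) := a ^+ (q ^ r) * z ^+ (q ^ (2 * r)) + a * z.
Definition radical := [set z : F | polar z == 0].

Lemma polarZ s (z : F) : s \in K -> polar (s * z) = s * polar z.
Proof.
by move=> Ks; rewrite /polar mulrDr exprMn (Fq_Frob _ Ks) !(mulrCA s).
Qed.

Lemma polarD : {morph polar : x y / x + y}.
Proof. by move=> x y; rewrite /polar (FrobD q_char) !mulrDr addrACA. Qed.

Lemma polarN : {morph polar : x / - x}.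
Proof. by move=> x; rewrite /polar (FrobN q_char) !mulrN opprD. Qed.

Lemma polarB : {morph polar : x y / x - y}.
Proof. by move=> x y; rewrite polarD polarN. Qed.

Lemma radical0 : 0 \in radical.
Proof. by have /eqP := polarB 0 0; rewrite !subrr inE. Qed.

Lemma radical_stable x y s :
  x \in radical -> y \in radical -> s \in K -> x + s * y \in radical.
Proof.
move=> + + Ks; rewrite !inE => /eqP fx /eqP fy.
by rewrite polarD polarZ // fx fy mulr0 addr0.
Qed.

(** The left-hand side is the symmetric bilinear form attached to [form]; the trace
    does not see that its second term is raised to the power [q ^ r]. *)
Lemma trace_cross (x z : F) :
  T (a * (x ^+ (q ^ r) * z)) + T (a * (z ^+ (q ^ r) * x))
    = T (x ^+ (q ^ r) * polar z).
Proof.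
rewrite -[T (a * (z ^+ _ * x))](trace_Frob cardF r) -(traceD l q_char).
congr (trace q l _); rewrite !exprMn -exprM -expnD addnn -mul2n /polar; ring.
Qed.

Lemma formD x z : form (x + z) = form x + T (x ^+ (q ^ r) * polar z) + form z.
Proof.
rewrite -trace_cross /form -!(traceD l q_char) !addn1 !exprSr (FrobD q_char).
congr (trace q l _); ring.
Qed.

Lemma form_Fq x : form x \in K. Proof. exact: (trace_Fq q_char cardF). Qed.

Lemma form0 : form 0 = 0.
Proof. by rewrite /form addn1 exprS mul0r mulr0 (trace0 l q_char). Qed.

Let u_gt0 : (0 < u)%N.
Proof. by have := l_gt0 cardF; rewrite l_def; case: (u). Qed.

Lemma Frob_odd_multiple (x : F) :
  x ^+ (q ^ (2 * u)) = x -> x ^+ (q ^ r) = x ^+ (q ^ u).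
Proof.
move=> x2u; rewrite r_def (_ : u * j.*2.+1 = j * (2 * u) + u)%N; last by lia.
by rewrite expnD exprM (Frob_period _ x2u).
Qed.

Lemma sum_antiperiodic (g : nat -> F) d m :
  (forall i, g (d + i)%N = - g i) -> \sum_(i < 2 * d * m) g i = 0.
Proof.
move=> g_anti; elim: m => [|m IHm]; first by rewrite muln0 big_ord0.
rewrite mulnS mul2n -addnn -addnA !big_split_ord /= addrA.
rewrite -big_split big1 => [|i _]; last by rewrite /= g_anti addrN.
rewrite add0r -[RHS]IHm mul2n -addnn; apply: eq_bigr => i _.
by rewrite !g_anti opprK.
Qed.

Lemma trace_antifixed (w : F) : w ^+ (q ^ u) = - w -> T w = 0.
Proof.
move=> wu; rewrite /trace l_def.
apply: (sum_antiperiodic (g := fun i => w ^+ (q ^ i))) => i.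
by rewrite expnD exprM wu (FrobN q_char).
Qed.

(** For [z] in the radical, [w = a z ^ (q ^ r + 1)] satisfies [w ^ (q ^ r) = - w].
    This settles characteristic two as well, where [2 * form z = 0] says nothing. *)
Lemma form_radical z : z \in radical -> form z = 0.
Proof.
rewrite inE => /eqP fz; apply: trace_antifixed; set w := a * _.
have wr : w ^+ (q ^ r) = - w.
  apply/eqP; rewrite -addr_eq0 /w exprMn addn1 exprS exprMn -exprM -expnD addnn -mul2n.
  apply/eqP; transitivity (z ^+ (q ^ r) * polar z); last by rewrite fz mulr0.
  rewrite /polar; ring.
rewrite -Frob_odd_multiple // -gcd_rl; apply: (Frob_gcd).
  by rewrite mul2n -addnn expnD exprM wr (FrobN q_char) wr opprK.
exact: (Frob_full cardF).
Qed.

(** The radical is a line over the field of [q ^ (2 u)] elements, unless it is zero. *)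
Lemma radical_eq_scale (w z : F) :
  w \in radical -> w != 0 -> (w * z \in radical) = (z ^+ (q ^ (2 * u)) == z).
Proof.
rewrite !inE => /eqP fw w_neq0.
have -> : polar (w * z) = - (a * w) * (z ^+ (q ^ (2 * r)) - z).
  move/eqP: fw; rewrite addr_eq0 => /eqP fw.
  by rewrite /polar exprMn [a ^+ _ * _]mulrA fw; ring.
rewrite mulf_eq0 oppr_eq0 !mulf_eq0 (negbTE a_neq0) (negbTE w_neq0) subr_eq0 /=.
apply/eqP/eqP => [z2r | z2u].
  rewrite -gcd_rl; apply: (Frob_gcd) => //.
  exact: (Frob_full cardF).
rewrite r_def (_ : 2 * (u * j.*2.+1) = j.*2.+1 * (2 * u))%N; last by lia.
exact: Frob_period.
Qed.

Lemma card_radical w : w \in radical -> w != 0 -> #|radical| = (q ^ (2 * u))%N.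
Proof.
move=> Rw w_neq0; rewrite -(card_Frob_fixed q_char cardF (d := 2 * u)); last first.
- by rewrite l_def dvdn_mulr.
- by rewrite muln_gt0.
rewrite -[RHS](card_imset _ (mulfI w_neq0)); apply: eq_card => z.
apply/idP/imsetP => [Rz | [v]].
  exists (z / w); last by rewrite mulrC divfK.
  by rewrite inE -(radical_eq_scale _ Rw) // mulrC divfK.
by rewrite inE -(radical_eq_scale _ Rw) // => ? ->.
Qed.

(** * Level sets of the form *)

Definition level (t : F) := [set x | form x == t].

Lemma qu1_dvd : ((q ^ u).-1 * (q ^ u + 1) %| #|F|.-1)%N.
Proof.
have qu_gt0 := Frob_gt0 q_char u.
rewrite cardF l_def [(2 * u)%N]mulnC !expnM.
rewrite (_ : ((q ^ u).-1 * (q ^ u + 1) = ((q ^ u) ^ 2).-1)%N) ?dvdn_pred_predX //.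
by rewrite -!subn1 -[in RHS](exp1n 2) subn_sqr.
Qed.

(** If [h ^ (q ^ u + 1)] is fixed by the Frobenius map, then [h] lies in the field of
    [q ^ (2 u)] elements, on which the odd multiples [r] and [u] of [u] give the
    same power of Frobenius. *)
Lemma form_scale (h x : F) :
  h ^+ (q ^ u + 1) \in K -> form (h * x) = h ^+ (q ^ u + 1) * form x.
Proof.
move=> Kh; have [-> | h_neq0] := eqVneq h 0.
  by rewrite mul0r form0 addn1 exprS !mul0r.
have h2u : h ^+ (q ^ (2 * u)) = h.
  have := Fq_Frob u Kh; rewrite -exprM mulnDl mul1n -expnD addnn -mul2n.
  by rewrite !exprD expr1 mulrC => /(mulfI (expf_neq0 _ h_neq0)).
have hr : h ^+ (q ^ r + 1) = h ^+ (q ^ u + 1).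
  by rewrite !exprD (Frob_odd_multiple h2u).
by rewrite /form exprMn mulrCA hr (traceZ l _ Kh).
Qed.

Lemma card_level_neq0 t : t \in K -> t != 0 -> #|level t| = #|level 1|.
Proof.
move=> Kt t_neq0.
have [h ht] : exists h, h ^+ (q ^ u + 1) = t.
  apply: (unity_root_is_power (e := (q ^ u).-1)); first by rewrite mulnC qu1_dvd.
  apply: (mulfI t_neq0).
  by rewrite -exprS prednK ?(Frob_gt0 q_char) // (Fq_Frob _ Kt) ?mulr1.
have h_neq0 : h != 0.
  by apply: contraNneq t_neq0 => h0; rewrite -ht h0 addn1 exprS mul0r.
rewrite -(card_imset (mem (level 1)) (mulfI h_neq0)); apply: eq_card => x.
apply/idP/imsetP => [|[y]]; rewrite !inE => /eqP Qx.
  exists (x / h); last by rewrite mulrC divfK.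
  rewrite inE -(inj_eq (mulfI t_neq0)) -{1}ht -form_scale ?ht //.
  by rewrite mulrC divfK // Qx mulr1.
by move=> ->; rewrite form_scale ht // Qx mulr1.
Qed.

Lemma form_equidistribution z t : polar z != 0 -> t \in K ->
  (#|[set x | T (x ^+ (q ^ r) * polar z)%R == t]| * q)%N = #|F|.
Proof.
move=> fz Kt; have [v Tv] := trace_form_nondeg q_char cardF fz.
rewrite -[RHS]cardsT.
rewrite -[RHS](trace_equidistribution q_char cardF (U := setT) _ Tv Kt)
  => [|? ?]; last by rewrite !in_setT.
congr (_ * _)%N; rewrite -[LHS](card_imset _ (Frob_inj q_char (i := r))).
apply: eq_card => x; apply/imsetP/idP => [[y /[!inE] Ty ->] // | /[!inE] Tx].
by have [y yx] := Frob_surj q_char r x; exists y; rewrite ?inE yx.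
Qed.

Lemma sum_levels : (#|level 0%R| + q.-1 * #|level 1%R|)%N = (q ^ l)%N.
Proof.
have K0 := Fq0 q_char.
rewrite -cardF -[RHS]sum1_card (partition_big form (mem K)) /=; last first.
  by move=> *; apply: form_Fq.
rewrite (big_setD1 0) //= sum1dep_card; congr (_ + _)%N.
rewrite (eq_bigr (fun=> #|level 1|)) => [|t].
  by rewrite sum_nat_const (card_Fq_neq0 q_char cardF).
rewrite in_setD1 => /andP[t_neq0 Kt].
by rewrite sum1dep_card -(card_level_neq0 Kt t_neq0).
Qed.

Lemma second_moment_levels :
  (\sum_x #|level (form x)| = #|level 0%R| ^ 2 + q.-1 * #|level 1%R| ^ 2)%N.
Proof.
have K0 := Fq0 q_char.
rewrite (partition_big form (mem K)) /=; last by move=> *; apply: form_Fq.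
have levelE t : (\sum_(x | form x == t) #|level (form x)| = #|level t| ^ 2)%N.
  rewrite (eq_bigr (fun=> #|level t|)) => [|x /eqP-> //].
  by rewrite sum_nat_const; congr (_ * _)%N; apply: eq_card => x; rewrite !inE.
rewrite (big_setD1 0) //= levelE; congr (_ + _)%N.
rewrite (eq_bigr (fun=> #|level 1%R| ^ 2)%N) => [|t].
  by rewrite sum_nat_const (card_Fq_neq0 q_char cardF).
rewrite in_setD1 => /andP[t_neq0 Kt].
by rewrite levelE card_level_neq0.
Qed.

(** The pairs with equal values, sorted by their difference [z]: the condition on [x]
    is linear, and void exactly when [z] lies in the radical. *)
Lemma second_moment_radical :
  ((\sum_x #|level (form x)|) * q
     = #|radical| * (q ^ l * q) + (q ^ l - #|radical|) * q ^ l)%N.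
Proof.
have -> : (\sum_x #|level (form x)|
    = \sum_z #|[set x | T (x ^+ (q ^ r) * polar z)%R == - form z]|)%N.
  transitivity (\sum_x \sum_(z | form (x + z)%R == form x) 1)%N.
    apply: eq_bigr => x _; rewrite -sum1_card (reindex_inj (addrI x)) /=.
    by apply: eq_bigl => z; rewrite inE.
  rewrite (exchange_big_dep xpredT) //=; apply: eq_bigr => z _.
  rewrite sum1dep_card; apply: eq_card => x; rewrite !inE formD.
  by rewrite -addrA -[X in _ == X]addr0 (inj_eq (addrI _)) addr_eq0.
rewrite big_distrl /= (bigID (mem radical)) /=; congr (_ + _)%N.
  rewrite -sum_nat_const; apply: eq_bigr => z Rz; congr (_ * _)%N.
  rewrite -cardF; apply: eq_card => x; rewrite inE form_radical //.
  by move: Rz; rewrite inE => /eqP->; rewrite mulr0 (trace0 l q_char) oppr0 eqxx.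
rewrite -cardF -(cardsC radical) addKn -sum_nat_const.
rewrite [RHS](eq_bigl (fun z => z \notin radical)) => [|z]; last first.
  by rewrite inE.
apply: eq_bigr => z; rewrite inE cardsC => fz; apply: form_equidistribution => //.
by rewrite -sub0r (FqB q_char) ?(Fq0 q_char) ?form_Fq.
Qed.

Definition gap : int := (#|level 0|)%:Z - (#|level 1|)%:Z.

Lemma gap_sqr : gap ^+ 2 = (#|radical| * q ^ l)%N%:Z.
Proof.
have leR : (#|radical| <= q ^ l)%N by rewrite -cardF max_card.
apply: (two_level_variance (q_gt1 q_char cardF) leR sum_levels).
by rewrite -second_moment_levels second_moment_radical.
Qed.

(** Scalars of norm one act freely on the level set over [1] and on the nonzero part
    of the level set over [0]. *)
Lemma gap_mod : exists m : int, gap = 1 + m * (q ^ u + 1)%N%:Z.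
Proof.
have dvd_qu : (q ^ u + 1 %| #|F|.-1)%N.
  by apply: dvdn_trans qu1_dvd; rewrite dvdn_mull.
have stable t h x : h ^+ (q ^ u + 1) = 1 -> form x = t -> form (h * x) = t.
  by move=> h1 <-; rewrite form_scale h1 ?mul1r //; apply/FqP; rewrite expr1n.
have /dvdnP[m1 Dm1] : (q ^ u + 1 %| #|level 1%R|)%N.
  apply: (dvdn_card_unity_stable dvd_qu) => [|h x h1]; rewrite !inE.
    by rewrite form0 eq_sym oner_eq0.
  by move/eqP/(stable _ _ _ h1)->.
have /dvdnP[m0 Dm0] : (q ^ u + 1 %| #|level 0%R :\ 0%R|)%N.
  apply: (dvdn_card_unity_stable dvd_qu) => [|h x h1]; rewrite !inE ?eqxx //.
  case/andP=> x_neq0 /eqP/(stable _ _ _ h1)->; rewrite mulf_neq0 //=.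
  by apply: contra_eq_neq h1 => ->; rewrite addn1 exprS mul0r eq_sym oner_eq0.
exists (m0%:Z - m1%:Z); rewrite /gap Dm1 (cardsD1 0) Dm0 inE form0 eqxx.
by rewrite PoszD !PoszM mulrBl addrA.
Qed.

(** The square of the gap gives it up to sign.  Modulo [q ^ u + 1] the power
    [q ^ (u (k + i))] is [(-1) ^ (k + i)] while the gap is [1]; the wrong sign would
    make [q ^ u + 1 > 2] a divisor of [2]. *)
Lemma gapE i : #|radical| = (q ^ (2 * u * i))%N ->
  gap = (-1) ^+ (k + i) * q%:Z ^+ (u * (k + i)).
Proof.
move=> cardR; set e := (k + i)%N; have [m Dm] := gap_mod.
have q1 := q_gt1 q_char cardF.
have s_gt1 : (1 < q ^ u)%N by rewrite -{1}(expn0 q) ltn_exp2l.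
set s := q%:Z ^+ u.
have sE : s = (q ^ u)%N%:Z by rewrite /s -!natz natrX.
have /eqP : gap ^+ 2 = (s ^+ e) ^+ 2.
  rewrite gap_sqr cardR l_def -expnD -mulnDr addnC /s -!exprM -!natz natrX.
  by congr (_ ^+ _); lia.
have [m' Dm'] : exists m', s ^+ e = (-1) ^+ e + m' * (s + 1).
  rewrite -[s ^+ e](subrK ((-1) ^+ e)) subrXX opprK [_ + (-1) ^+ e]addrC mulrC.
  by eexists; reflexivity.
rewrite exprM -/s eqf_sqr; move: Dm; rewrite PoszD -sE => Dm.
rewrite -signr_odd in Dm' *.
case/orP=> /eqP Dg; rewrite Dg; move: Dm; rewrite Dg Dm'; case: (odd e) => /=;
  rewrite ?expr0 ?expr1 ?mul1r ?mulN1r // => E; exfalso; move: E; rewrite sE => E.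
  have /eqP[] := succ_ndvd2 (m' - m) s_gt1.
  set t := _ + 1 in E *.
  by transitivity (-1 + m' * t + 1 - m * t); [ring | rewrite E; ring].
have /eqP[] := succ_ndvd2 (- m' - m) s_gt1.
set t := _ + 1 in E *.
by transitivity (- (1 + m' * t) + 1 - m * t); [ring | rewrite E; ring].
Qed.

(** * Zeros of the inhomogeneous function *)

Definition fibre (b c : F) :=
  [set x : F | T (a * x ^+ (q ^ r + 1) + b * x + c) == 0].

Lemma num_points_fibre b c : num_points q r a b c = (#|fibre b c| * q)%N.
Proof.
pose g x := a * x ^+ (q ^ r + 1) + b * x + c.
transitivity (\sum_x #|[set y : F | (y ^+ q - y)%R == g x]|)%N.
  under eq_bigr do rewrite -sum1_card.
  rewrite pair_big_dep /= /num_points -sum1_card.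
  by apply: eq_bigl => -[x y]; rewrite !inE.
under eq_bigr do rewrite (card_Artin_Schreier q_char cardF).
rewrite -big_mkcond -sum_nat_const.
by apply: eq_bigl => x; rewrite inE.
Qed.

Lemma complete_square b c x0 x : polar x0 = - b ^+ (q ^ r) ->
  T (a * (x + x0) ^+ (q ^ r + 1) + b * (x + x0) + c)
    = form x - T (a * x0 ^+ (q ^ r + 1) - c).
Proof.
move=> fx0.
have cross y : T (y ^+ (q ^ r) * polar x0) = - T (b * y).
  by rewrite fx0 mulrN (traceN l q_char) -exprMn (trace_Frob cardF) mulrC.
have := trace_cross x0 x0; rewrite cross => bx0.
have {}bx0 : T (b * x0) = - form x0 - form x0.
  by rewrite -[LHS]opprK -bx0 opprD /form addn1 exprSr.
rewrite !(traceD l q_char) -/(form _) formD cross mulrDr (traceD l q_char) bx0.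
rewrite (traceN l q_char) -/(form x0); ring.
Qed.

Lemma card_fibre_root b c x0 : polar x0 = - b ^+ (q ^ r) ->
  #|fibre b c| = #|level (T (a * x0 ^+ (q ^ r + 1) - c))|.
Proof.
move=> fx0; rewrite -[RHS](card_imset _ (addIr x0)); apply: eq_card => x.
apply/idP/imsetP => [|[y]]; rewrite !inE.
  rewrite -[x](subrK x0) (complete_square _ _ fx0) subr_eq0 => Qx.
  by exists (x - x0); rewrite ?inE.
by move=> Qy ->; rewrite (complete_square _ _ fx0) subr_eq0.
Qed.

(** Self-adjointness of [polar], up to a Frobenius twist, gives one inclusion.  Both
    sides have [#|F| / #|radical|] elements. *)
Lemma image_polar :
  [set polar x | x : F] = [set y ^+ (q ^ r) | y in trace_orthogonal q l radical].
Proof.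
apply/eqP; rewrite eqEcard; apply/andP; split.
  apply/subsetP=> _ /imsetP[x _ ->]; have [y yx] := Frob_surj q_char r (polar x).
  apply/imsetP; exists y => //; apply/trace_orthogonalP => z.
  rewrite inE => /eqP fz.
  rewrite -(trace_Frob cardF r) exprMn yx -trace_cross addrC trace_cross fz mulr0.
  exact: (trace0 l q_char).
have R_gt0 : (0 < #|radical|)%N by apply/card_gt0P; exists 0; apply: radical0.
rewrite (card_imset _ (Frob_inj q_char (i := r))) -(leq_pmul2l R_gt0).
rewrite (card_orthogonal q_char cardF radical0 radical_stable).
by rewrite -(card_additive_kernel_image polarB) mulnC.
Qed.

(** A root exists when [b] is orthogonal to the radical.  Otherwise some [z] in the
    radical has [T (b z) != 0], and translation by [s z] adds [s T (b z)]. *)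
Lemma card_fibre_no_root b c :
  (forall x, polar x != - b ^+ (q ^ r)) -> (#|fibre b c| * q)%N = (q ^ l)%N.
Proof.
move=> no_root.
have : b \notin trace_orthogonal q l radical.
  apply/negP=> Ob; have : (- b) ^+ (q ^ r) \in [set polar x | x : F].
    rewrite image_polar; apply/imsetP; exists (- b) => //.
    apply/trace_orthogonalP => z Rz.
    move/trace_orthogonalP: Ob => /(_ z Rz) Tzb.
    by rewrite mulrN (traceN l q_char) Tzb oppr0.
  case/imsetP=> x _; rewrite (FrobN q_char) => fx.
  by have := no_root x; rewrite fx eqxx.
rewrite inE negb_forall_in => /exists_inP[z Rz Tz].
rewrite -cardF -cardsT.
rewrite -[RHS](translation_equidistribution q_char cardF (U := setT) (v := z)
  (P := fun x => T (a * x ^+ (q ^ r + 1) + b * x + c)) _ _ _ Tz _ (Fq0 q_char)).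
- by congr (_ * _)%N; apply: eq_card => x; rewrite !inE.
- by move=> *; rewrite inE.
- by move=> *; apply: (trace_Fq q_char cardF).
- exact: (trace_Fq q_char cardF).
move=> x s _ Ks.
rewrite !(traceD l q_char) -!/(form _) formD.
rewrite polarZ // (eqP (_ : polar z == 0)); last by move: Rz; rewrite inE.
have Rsz : s * z \in radical by rewrite -[_ * _]add0r radical_stable ?radical0.
rewrite (form_radical Rsz) !mulr0 (trace0 l q_char) mulrDr (traceD l q_char) mulrCA.
rewrite (traceZ l _ Ks) [b * z]mulrC; ring.
Qed.

End HermitianForm.

(** * The trace as a sum over the Galois group *)

(** The Galois group is cyclic, generated by the Frobenius map. *)
Lemma field_traceE (K : finFieldType) (L : fieldExtType K) (l : nat) :
    #|finvect_type L| = (#|K| ^ l)%N ->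
  forall x : finvect_type L, field_trace x = trace #|K| l x.
Proof.
move=> cardL x; have sub1L : (1 <= {:finvect_type L})%VS := sub1v _.
have [alpha /eqP gen_alpha alphaE] := finField_galois_generator sub1L.
have dimL : \dim {:finvect_type L} = l.
  apply/eqP; rewrite -(eqn_exp2l _ _ (finNzRing_gt1 K)) -cardL.
  by rewrite -card_vspace card_vspacef.
have ord_alpha : #[alpha]%g = l.
  rewrite orderE -gen_alpha -galois_dim ?finField_galois //.
  by rewrite dimv1 divn1 dimL.
have alphaXE i : (alpha ^+ i)%g x = x ^+ (#|K| ^ i).
  elim: i => [|i IHi]; first by rewrite gal_id expr1.
  by rewrite expgSr galM ?memvf // IHi alphaE ?memvf // dimv1 expn1 expnSr exprM.
rewrite /field_trace /galTrace gen_alpha.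
have -> : <[alpha]>%g = [set (alpha ^+ (i : nat))%g | i : 'I_l].
  apply/setP=> g; apply/idP/imsetP => [/cyclePmin[i] | [i _ ->]].
    by rewrite ord_alpha => lt_i ->; exists (Ordinal lt_i).
  exact: mem_cycle.
rewrite big_imset /= => [|i j _ _ /eqP].
  by apply: eq_bigr => i _; apply: alphaXE.
by rewrite eq_expg_mod_order ord_alpha !modn_small // => /eqP/val_inj.
Qed.

(** * The number of points *)

Lemma even_quotient_decomposition l r : (0 < l)%N -> ~~ odd (l %/ gcdn l r) ->
  exists k j, [/\ l = (2 * gcdn l r * k)%N, r = (gcdn l r * j.*2.+1)%N
                & gcdn (2 * r) l = (2 * gcdn l r)%N].
Proof.
move=> l_gt0; set u := gcdn l r; set m := (l %/ u)%N => even_m.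
have u_gt0 : (0 < u)%N by rewrite gcdn_gt0 l_gt0.
have lE : l = (u * m)%N by rewrite mulnC divnK ?dvdn_gcdl.
have rE : r = (u * (r %/ u))%N by rewrite mulnC divnK ?dvdn_gcdr.
have co_mr : coprime m (r %/ u).
  by rewrite /coprime -(eqn_pmul2l u_gt0) muln_gcdr -lE -rE muln1.
have mE : m = (2 * m./2)%N by rewrite mul2n even_halfK.
have odd_r : odd (r %/ u) by move: co_mr; rewrite mE coprimeMl coprime2n => /andP[].
have l2E : l = (2 * u * m./2)%N by rewrite {1}lE {1}mE mulnCA mulnA.
exists m./2, (r %/ u)./2; split=> //.
  by rewrite {1}rE; congr (_ * _)%N; have := odd_double_half (r %/ u); rewrite odd_r.
rewrite mE coprimeMl in co_mr; have [_ /eqP co2_mr] := andP co_mr.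
by rewrite {1}rE {1}l2E mulnA -muln_gcdr gcdnC co2_mr muln1.
Qed.

Theorem theorem3p6 (p n q l r : nat) (K : finFieldType) (L : fieldExtType K)
    (p_prime : prime p) (n_gt0 : (0 < n)%N) (q_def : q = (p ^ n)%N)
    (cardK : #|K| = q) (cardL : #|finvect_type L| = (q ^ l)%N)
    (l_ge2 : (2 <= l)%N) (lu_even : ~~ odd (l %/ gcdn l r)%N)
    (a b c : finvect_type L) (a_neq0 : a != 0) :
  let u := gcdn l r in
  let f := f_poly q r a in
  let N : int := (num_points q r a b c)%:Z in
  ((~ exists x : finvect_type L, f.[x] = - b ^+ (q ^ r)%N) ->
     N = (q ^ l)%N%:Z)
  /\
  (forall x0 : finvect_type L, f.[x0] = - b ^+ (q ^ r)%N ->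
     let c1 := a * x0 ^+ (q ^ r + 1)%N - c in
     (permutation_poly f ->
        (field_trace c1 = 0 ->
           N = (q ^ l)%N%:Z
               + (-1) ^+ (l %/ (2 * u))%N * q%:Z ^+ (l %/ 2)%N * (q%:Z - 1))
        /\
        (field_trace c1 <> 0 ->
           N = (q ^ l)%N%:Z
               + (-1) ^+ (l %/ (2 * u) + 1)%N * q%:Z ^+ (l %/ 2)%N))
     /\
     (~ permutation_poly f ->
        (field_trace c1 = 0 ->
           N = (q ^ l)%N%:Z
               + (-1) ^+ (l %/ (2 * u) + 1)%N
                 * q%:Z ^+ (l %/ 2 + u)%N * (q%:Z - 1))
        /\
        (field_trace c1 <> 0 ->
           N = (q ^ l)%N%:Z
               + (-1) ^+ (l %/ (2 * u))%N * q%:Z ^+ (l %/ 2 + u)%N))).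
Proof.
have l_gt0 : (0 < l)%N := ltnW l_ge2.
have p_char : p \in [pchar (finvect_type L)].
  by apply: (@card_finPcharP _ _ (n * l)); rewrite // cardL q_def expnM.
have q_char : [pchar (finvect_type L)].-nat q.
  by rewrite q_def pnatX (eq_pnat _ (pcharf_eq p_char)) pnat_id.
have [k [j [lE rE gcd_rl]]] := even_quotient_decomposition l_gt0 lu_even.
move=> u f N; rewrite -/u in lE rE gcd_rl.
have fE x : f.[x] = polar q r a x.
  by rewrite /f /f_poly hornerD !hornerZ hornerXn hornerX.
have NE : N = (#|fibre q l r a b c| * q)%N%:Z.
  by rewrite /N (num_points_fibre r a q_char cardL).
have u_gt0 : (0 < u)%N by rewrite gcdn_gt0 l_gt0.
have q_gt0 := q_gt0 q_char.
have l2 : (l %/ 2 = u * k)%N by rewrite lE -mulnA mulKn.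
have lu : (l %/ (2 * u) = k)%N by rewrite {1}lE mulKn ?muln_gt0.
split=> [no_root | x0 fx0 c1].
  rewrite NE; congr Posz; apply: (card_fibre_no_root q_char cardL lE rE gcd_rl) => // x.
  by apply/eqP=> fx; case: no_root; exists x; rewrite fE.
have {}NE : N = (#|level q l r a (trace q l c1)| * q)%N%:Z.
  by rewrite NE (card_fibre_root q_char cardL _ (x0 := x0)) // -fE.
have N0 : field_trace c1 = 0 -> N = (q ^ l)%N%:Z + gap q l r a * (q%:Z - 1).
  rewrite (field_traceE (l := l)) cardK // => Tc1; rewrite NE Tc1.
  rewrite -(sum_levels q_char cardL lE rE gcd_rl a_neq0) /gap.
  rewrite PoszD !PoszM predn_int //; ring.
have N1 : field_trace c1 <> 0 -> N = (q ^ l)%N%:Z - gap q l r a.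
  rewrite (field_traceE (l := l)) cardK // => /eqP Tc1; rewrite NE.
  rewrite (card_level_neq0 q_char cardL lE rE gcd_rl) ?(trace_Fq q_char cardL) //.
  rewrite -(sum_levels q_char cardL lE rE gcd_rl a_neq0) /gap.
  rewrite PoszD !PoszM predn_int //; ring.
have gap_i := gapE q_char cardL lE rE gcd_rl a_neq0.
split=> perm_f.
  (* The exponent is written so that [gapE] applies with [i = 0]. *)
  have cardR : #|radical q r a| = (q ^ (2 * u * 0))%N.
    rewrite muln0 expn0 -(cards1 (0 : finvect_type L)); apply: eq_card => x.
    rewrite !inE -fE; apply/eqP/eqP => [fx | ->].
      apply: (bij_inj perm_f); rewrite fx fE; apply/esym/eqP.
      by have := radical0 r a q_char; rewrite inE.
    by apply/eqP; rewrite fE; have := radical0 r a q_char; rewrite inE.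
  have := gap_i _ cardR; rewrite !addn0 => gap0.
  by rewrite l2 lu; split=> [/N0 | /N1] ->; rewrite gap0 // exprD expr1; ring.
have [w Rw w_neq0] : exists2 w, w \in radical q r a & w != 0.
  apply/exists_inP; apply/contraT; rewrite negb_exists_in => /forall_inP R0.
  case: perm_f; apply: injF_bij => x y; rewrite !fE => /eqP.
  rewrite -subr_eq0 -(polarB r a q_char) => Rxy; apply/eqP; rewrite -subr_eq0.
  by rewrite -[_ == _]negbK R0 ?inE.
have cardR : #|radical q r a| = (q ^ (2 * u * 1))%N.
  by rewrite muln1 (card_radical q_char cardL lE rE gcd_rl a_neq0 Rw).
have gap1 := gap_i _ cardR; rewrite mulnDr muln1 in gap1.
by rewrite l2 lu; split=> [/N0 | /N1] ->; rewrite gap1 // exprD expr1; ring.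
Qed.
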